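(* Let $k\in\mathbb Z_{>0}$ and $m_1,m_2\in\mathbb Z$. Then $$\Sigma(2^k,2^k;m_1,m_2)=2^k\delta_{2|k}\sum_{i=0}^{k-1}\big(g_1(2^2,m_1,2^{k-i})+(-1)^{i+1}g_{-1}(2^2,m_1,2^{k-i})\big)\big(g_1(2^2,m_2,2^{i+1})+(-1)^ig_{-1}(2^2,m_2,2^{i+1})\big).$$
   Context: $\delta_P$ is $1$ if the statement $P$ holds and $0$ otherwise. $(\frac{\cdot}{\cdot})$ is the Kronecker symbol; for nonzero reals $(x,y)_{\mathbb R}=-1$ if $x,y<0$ and $1$ otherwise. For $\epsilon=\pm1$ and $n\ge2$, $g_\epsilon(2^2,m,2^n)=\sum_{x\in(\mathbb Z/2^n\mathbb Z)^\times,\ x\equiv\epsilon\,(\mathrm{mod}\,4)}e^{2\pi i mx/2^n}$. For $n=1$ (where the residue mod $4$ is not defined) the convention is $g_\epsilon(2^2,m,2)=\tfrac12g_\epsilon(2^2,2m,4)=\tfrac12(-1)^m$, so that $g_1(2^2,m,2)+g_{-1}(2^2,m,2)=\sum_{x\in(\mathbb Z/2)^\times}e^{\pi imx}=(-1)^m$. $\Gamma=\Gamma_1(4)$ is the group of $\gamma\in\mathrm{SL}(3,\mathbb Z)$ congruent mod $4$ to an upper triangular unipotent matrix, and $\Gamma_\infty$ is the group of upper triangular unipotent matrices in $\mathrm{SL}(3,\mathbb Z)$. The Plücker coordinates of a matrix with second row $(d,e,f)$ and third row $(g,h,i)$ are $(-g,-h,-i,-(dh-eg),di-fg,-(ei-fh))$;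 for $\gamma\in\Gamma$ they are written $(4A_1,4B_1,C_1,4A_2,4B_2,C_2)$ with integers $A_i,B_i,C_i$ (they satisfy $A_1C_2+4B_1B_2+C_1A_2=0$, $\gcd(A_i,B_i,C_i)=1$, $C_i\equiv-1$ mod $4$, and such tuples parametrize $\Gamma_\infty\backslash\Gamma$). Splitting: $s:\Gamma\to\{\pm1\}$ is the function such that $\gamma\mapsto(\gamma,s(\gamma))$ is Miller's splitting homomorphism of $\Gamma$ into the double cover of $\mathrm{SL}(3,\mathbb R)$; it is left and right $\Gamma_\infty$-invariant and for $A_1,A_2\neq0$ it is determined as follows. If $A_1>0$ and $A_2/D$ is odd, with $D=\gcd(A_1,A_2)$, $D_1=\gcd(D,B_1)$, $D_2=D/D_1$, $\epsilon=(\frac{-1}{B_1/D_1})$, then $$s(\gamma)=\Big(\tfrac{\epsilon}{-A_1A_2}\Big)\Big(\tfrac{A_1/D}{A_2/D}\Big)\Big(\tfrac{B_1/D_1}{A_1/D}\Big)\Big(\tfrac{4B_2/D_2}{|A_2|/D}\Big)\Big(\tfrac{D_1}{C_1}\Big)\Big(\tfrac{D_2}{C_2}\Big);$$ the remaining cases follow from $s(S_3\gamma S_3)=s(\gamma)$ with $S_3=\mathrm{diag}(1,1,-1)$, and $s(w_\ell{}^\intercal\gamma^{-1}w_\ell^{-1})=(-A_1,-A_2)_{\mathbb R}s(\gamma)$ with $w_\ell=\begin{pmatrix}0&0&1\\0&-1&0\\1&0&0\end{pmatrix}$. Exponential sums: for nonzero integers $A_1,A_2$, $\mathbb S(A_1,A_2)$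 is the set of $\gamma\in\Gamma$ with Plücker coordinates $(4A_1,*,*,4A_2,*,* )$, and $\Sigma(A_1,A_2;m_1,m_2)=\sum_{\gamma\in\Gamma_\infty\backslash\mathbb S(A_1,A_2)/\Gamma_\infty}s(\gamma)e^{2\pi i(m_1\frac{B_1}{A_1}+m_2\frac{B_2}{A_2})}$ for $m_1,m_2\in\mathbb Z$. *)

(* Defs.v *)
From mathcomp Require Import all_boot all_order all_algebra.
From mathcomp Require Import mathcomp_extra boolp classical_sets functions.
From mathcomp Require Import cardinality fsbigop reals trigo.
From mathcomp Require Import complex.

Set Implicit Arguments.
Unset Strict Implicit.
Unset Printing Implicit Defensive.

Import Order.TTheory GRing.Theory Num.Theory.

Local Open Scope classical_set_scope.
Local Open Scope ring_scope.

(* The symbol (a / p) for a prime p: the Legendre symbol for odd p. *)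
Definition kronecker_prime (a : int) (p : nat) : int :=
  if (p %| a)%Z then 0
  else if p == 2%N then
    if (a == 1 %[mod 8])%Z || (a == -1 %[mod 8])%Z then 1 else -1
  else if [exists x : 'I_p, (x%:Z ^+ 2 == a %[mod p])%Z] then 1 else -1.

(* The Kronecker symbol (a / n), with (a / -1) = -1 exactly when a < 0, and    *)
(* (a / 0) = 1 for a = 1 or a = -1 and 0 otherwise.                            *)
Definition kronecker (a n : int) : int :=
  if n == 0 then (`|a|%N == 1%N)%:R
  else (if (a < 0) && (n < 0) then -1 else 1) *
       \prod_(p <- primes `|n|) kronecker_prime a p ^+ logn p `|n|.

(* (x, y)_R, for nonzero x and y. *)
Definition real_hilbert (R : realDomainType) (x y : R) : int :=
  if (x < 0) && (y < 0) then -1 else 1.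

Definition expi2pi (R : realType) (x : R) : R[i] :=
  (cos (2 * pi * x) +i* sin (2 * pi * x))%C.

(* The defining sum of g_eps(2^2, m, 2^n) for n >= 2. *)
Definition gauss_unit_sum (R : realType) (eps m : int) (n : nat) : R[i] :=
  \sum_(x < (2 ^ n)%N |
         coprime x (2 ^ n) && (x%:Z == eps %[mod 4])%Z)
     expi2pi (m%:~R * x%:R / 2 ^+ n : R).

(* g_eps(2^2, m, 2^n) for n >= 1. *)
Definition gauss (R : realType) (eps m : int) (n : nat) : R[i] :=
  if n == 1%N then 2^-1 * gauss_unit_sum R eps (2 * m) 2
  else gauss_unit_sum R eps m n.

Definition Gamma : set 'M[int]_3 :=
  [set gam | \det gam = 1 /\
     forall i j : 'I_3, (j <= i)%N -> (gam i j = (i == j)%:R %[mod 4])%Z].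

Definition Gamma_inf : set 'M[int]_3 :=
  [set gam | \det gam = 1 /\
     forall i j : 'I_3, (j <= i)%N -> gam i j = (i == j)%:R].

Definition plucker (gam : 'M[int]_3) : 6.-tuple int :=
  let d := gam 1 0 in let e := gam 1 1 in let f := gam 1 2 in
  let g := gam 2 0 in let h := gam 2 1 in let i := gam 2 2 in
  [tuple - g; - h; - i; - (d * h - e * g); d * i - f * g; - (e * i - f * h)].

(* On Gamma, the Plücker coordinates are (4 A1, 4 B1, C1, 4 A2, 4 B2, C2), the *)
(* divisions by 4 being exact.                                                 *)
Definition plA1 (gam : 'M[int]_3) : int := ((plucker gam)`_0 %/ 4)%Z.
Definition plB1 (gam : 'M[int]_3) : int := ((plucker gam)`_1 %/ 4)%Z.
Definition plC1 (gam : 'M[int]_3) : int := (plucker gam)`_2.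
Definition plA2 (gam : 'M[int]_3) : int := ((plucker gam)`_3 %/ 4)%Z.
Definition plB2 (gam : 'M[int]_3) : int := ((plucker gam)`_4 %/ 4)%Z.
Definition plC2 (gam : 'M[int]_3) : int := (plucker gam)`_5.

(* The formula for the splitting when A1 > 0 and A2 / gcd(A1, A2) is odd. All  *)
(* the divisions are exact, by A1 C2 + 4 B1 B2 + C1 A2 = 0.                    *)
Definition splitting_formula (gam : 'M[int]_3) : int :=
  let A1 := plA1 gam in let B1 := plB1 gam in let C1 := plC1 gam in
  let A2 := plA2 gam in let B2 := plB2 gam in let C2 := plC2 gam in
  let D := gcdz A1 A2 in
  let D1 := gcdz D B1 in
  let D2 := (D %/ D1)%Z in
  let eps := kronecker (-1) (B1 %/ D1)%Z in
  kronecker eps (- A1 * A2) *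
  kronecker (A1 %/ D)%Z (A2 %/ D)%Z *
  kronecker (B1 %/ D1)%Z (A1 %/ D)%Z *
  kronecker (4 * B2 %/ D2)%Z (`|A2| %/ D)%Z *
  kronecker D1 C1 *
  kronecker D2 C2.

Definition S3 : 'M[int]_3 :=
  \matrix_(i, j) if i == j then (if i == 2 then -1 else 1) else 0.

Definition w_long : 'M[int]_3 :=
  \matrix_(i, j) if (i + j == 2)%N then (if i == 1 then -1 else 1) else 0.

Definition S3_conj (gam : 'M[int]_3) : 'M[int]_3 := S3 *m gam *m S3.

Definition w_dual (gam : 'M[int]_3) : 'M[int]_3 :=
  w_long *m (invmx gam)^T *m invmx w_long.

(* Miller's splitting s(gam) of Gamma into the double cover of SL(3, R), for    *)
(* gam with A1 and A2 nonzero (no meaning is attached to the other values).    *)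
(* The cases not covered by splitting_formula are reduced to it by             *)
(* s(S3 gam S3) = s(gam), where A1 and A2 change sign, and by                  *)
(* s(w_dual gam) = (-A1, -A2)_R s(gam), where A1 and A2 are exchanged: when    *)
(* A2 / gcd(A1, A2) is even, A1 / gcd(A1, A2) is odd.                          *)
Definition splitting_odd (gam : 'M[int]_3) : int :=
  if 0 < plA1 gam then splitting_formula gam
  else splitting_formula (S3_conj gam).

Definition splitting (gam : 'M[int]_3) : int :=
  let A1 := plA1 gam in let A2 := plA2 gam in
  if ~~ (2 %| A2 %/ gcdz A1 A2)%Z then splitting_odd gam
  else real_hilbert (- A1) (- A2) * splitting_odd (w_dual gam).

Definition SS (A1 A2 : int) : set 'M[int]_3 :=
  [set gam | [/\ Gamma gam, (plucker gam)`_0 = 4 * A1 &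
                 (plucker gam)`_3 = 4 * A2]].

Definition double_coset (gam : 'M[int]_3) : set 'M[int]_3 :=
  [set u *m gam *m v | u in Gamma_inf & v in Gamma_inf].

Definition Sigma_term (R : realType) (m1 m2 : int) (gam : 'M[int]_3) : R[i] :=
  (splitting gam)%:~R *
  expi2pi (m1%:~R * ((plB1 gam)%:~R / (plA1 gam)%:~R) +
           m2%:~R * ((plB2 gam)%:~R / (plA2 gam)%:~R) : R).

(* The sum over the (finitely many) double cosets X; the term is constant on X *)
(* and is evaluated at a chosen element of X.                                  *)
Definition Sigma (R : realType) (A1 A2 m1 m2 : int) : R[i] :=
  \sum_(X \in [set double_coset gam | gam in SS A1 A2])
     Sigma_term R m1 m2 (xget 0 X).

(* Main.v *)
Require Import Defs.
From mathcomp Require Import all_boot all_order all_algebra.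
From mathcomp Require Import all_fingroup all_solvable finfield.
From mathcomp Require Import boolp classical_sets functions cardinality fsbigop.
From mathcomp Require Import reals trigo complex zify ring.

Set Implicit Arguments.
Unset Strict Implicit.
Unset Printing Implicit Defensive.

Import Order.TTheory GRing.Theory Num.Theory.
Local Open Scope ring_scope.

(* For A1 = A2 = 2^k the Plücker relation reads 2^k (C1 + C2) = - 4 B1 B2, and C1 + C2 = -2 mod 4,
   so B1 B2 has 2-adic valuation k - 1. Hence B1 = 2^a b1 and B2 = 2^(k - 1 - a) b2 with b1, b2
   odd and 0 <= a < k, and C2 = - C1 - 2 b1 b2. The right action of Gamma_inf translates b1 by
   2^(k - a), b2 by 2^(a + 1) and, once b1 and b2 are fixed, C1 by 4 * 2^k; so the double cosets
   correspond to the quadruples (a, b1 mod 2^(k - a), b2 mod 2^(a + 1), C1 mod 4 * 2^k).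
   The splitting is (-1 / b1) (2 / C1)^a (2 / C2)^(k - a), where
   (2 / C2) = (2 / C1) (-1 / b1) (-1 / b2) by the supplementary laws of quadratic reciprocity.
   The sum of (2 / C1)^k over C1 is 2^k for even k and 0 for odd k; for even k the sums over b1
   and b2 that remain are Gauss sums twisted by powers of (-1 / .). *)

(** * Supplementary laws of quadratic reciprocity *)

(* The symbols (-1 / n) and (2 / n) at odd n; the values at even n are junk. *)
Definition chi4 (n : int) : int := if (n == 1 %[mod 4])%Z then 1 else -1.
Definition chi8 (n : int) : int :=
  if (n == 1 %[mod 8])%Z || (n == -1 %[mod 8])%Z then 1 else -1.

Lemma chi4M m n : ~~ (2 %| m)%Z -> ~~ (2 %| n)%Z -> chi4 (m * n) = chi4 m * chi4 n.
Proof.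
rewrite /chi4 => Hm Hn.
have [m1 Em] : exists q, m = 4 * q + 1 \/ m = 4 * q + 3 by exists (m %/ 4)%Z; lia.
have [n1 En] : exists q, n = 4 * q + 1 \/ n = 4 * q + 3 by exists (n %/ 4)%Z; lia.
case: Em => ->; case: En => ->;
 do 3 (case: ifP => ?); lia.
Qed.

Lemma chi8M m n : ~~ (2 %| m)%Z -> ~~ (2 %| n)%Z -> chi8 (m * n) = chi8 m * chi8 n.
Proof.
rewrite /chi8 => Hm Hn.
have [m1 Em] : exists q, (m = 8 * q + 1 \/ m = 8 * q - 1) \/ (m = 8 * q + 3 \/ m = 8 * q - 3)
  by exists ((m + 3) %/ 8)%Z; lia.
have [n1 En] : exists q, (n = 8 * q + 1 \/ n = 8 * q - 1) \/ (n = 8 * q + 3 \/ n = 8 * q - 3)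
  by exists ((n + 3) %/ 8)%Z; lia.
case: Em => [] [] ->; case: En => [] [] ->;
 do 3 (case: ifP => ?); lia.
Qed.

(** This is prime factorisation plus multiplicativity. Asking for multiplicativity on odd numbers
    only allows [f] to be [chi4] or [chi8], which are junk at even arguments. *)
Lemma prod_primes_logn (f : nat -> int) n : f 1%N = 1 ->
  (forall m1 m2, odd m1 -> odd m2 -> f (m1 * m2)%N = f m1 * f m2) -> odd n ->
  \prod_(p <- primes n) f p ^+ logn p n = f n.
Proof.
move=> f1 fM odd_n; have n_gt0 : (0 < n)%N by case: n odd_n.
have fX m j : odd m -> f (m ^ j)%N = f m ^+ j.
  move=> odd_m; elim: j => [|j IHj]; first by rewrite expn0.
  by rewrite expnS exprS fM ?oddX ?odd_m ?orbT // IHj.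
have {3}-> : n = (\prod_(p <- primes n) p ^ logn p n)%N.
  by rewrite {1}(prod_prime_decomp n_gt0) prime_decompE big_map.
have odd_p p : p \in primes n -> odd p.
  by rewrite mem_primes => /and3P[_ _ pn]; apply: dvdn_odd pn odd_n.
elim: (primes n) odd_p => [|p s IHs] odd_p; first by rewrite !big_nil f1.
have odd_s q : q \in s -> odd q by move=> qs; apply: odd_p; rewrite inE qs orbT.
have pO : odd p by rewrite odd_p ?inE ?eqxx.
rewrite !big_cons fM ?fX ?IHs // ?oddX ?pO ?orbT //.
rewrite big_seq; elim/big_ind: _ => // [x y|q qs]; first by rewrite oddM => -> ->.
by rewrite oddX odd_s // orbT.
Qed.

(** The unit group is cyclic of order 2h with h = [#|F|./2]. If a = g^j and a^h = 1, then 2h divides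
    jh, so j is even and g^(j/2) is a square root of a. *)
Lemma euler_criterion (F : finFieldType) (a : F) : odd #|F| -> a != 0 ->
  [exists x, x ^+ 2 == a] = (a ^+ (#|F|./2) == 1).
Proof.
move=> oddF a0; have cardU := card_finField_unit F.
have cardE : (#|F|.-1 = #|F|./2 * 2)%N by rewrite muln2 -{1}(odd_double_half #|F|) oddF.
have aU : a \is a GRing.unit by rewrite unitfE.
have /cyclicP[g gE] : cyclic [set: {unit F}] by apply: field_unit_group_cyclic.
have ordg : #[g]%g = (#|F|./2 * 2)%N by rewrite orderE -gE cardU cardE.
apply/existsP/eqP => [[x /eqP xE]|ah].
  have x0 : x != 0 by rewrite -sqrf_eq0 xE.
  apply: (mulfI x0); rewrite mulr1 -xE -exprM -exprS mulnC -cardE prednK ?expf_card //.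
  by case: #|F| oddF.
have : FinRing.unit F aU \in <[g]>%g by rewrite -gE inE.
case/cycleP => j aE.
have : (g ^+ (j * #|F|./2) == 1)%g.
  rewrite -val_eqE /= expgM -aE FinRing.val_unitX /=; exact/eqP.
rewrite -order_dvdn ordg mulnC dvdn_pmul2r; last first.
  by have := finNzRing_gt1 F; case: #|F| oddF => [|[|[|n]]].
case/dvdnP => i jE; exists (val (g ^+ i)%g).
by rewrite -FinRing.val_unitX -expgM -jE -aE.
Qed.

(** Since 1 and -1 differ modulo an odd prime, the half power in 'F_p determines the symbol. Both
    supplementary laws enter in this form. *)
Lemma kronecker_prime_euler (p : nat) (a e : int) : prime p -> odd p ->
  e = 1 \/ e = -1 -> (a%:~R : 'F_p) ^+ p./2 = e%:~R -> kronecker_prime a p = e.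
Proof.
move=> p_pr p_odd eE ahE; have p_gt1 := prime_gt1 p_pr.
have dvdE (z : int) : (p %| z)%Z = (z%:~R == 0 :> 'F_p) by rewrite (dvdz_pcharf (pchar_Fp p_pr)).
have half_gt0 : (0 < p./2)%N by lia.
have e0 : (e%:~R : 'F_p) != 0 by case: eE => ->; rewrite ?mulrNz ?oppr_eq0 oner_eq0.
have a0 : (a%:~R : 'F_p) != 0.
  by apply: contraNneq e0 => a0; rewrite -ahE a0 expr0n; case: p./2 half_gt0.
rewrite /kronecker_prime dvdE (negbTE a0); case: ifP => [/eqP p2|_].
  by rewrite p2 in p_odd.
have -> : [exists x : 'I_p, (x%:Z ^+ 2 == a %[mod p])%Z] = [exists x : 'F_p, x ^+ 2 == a%:~R].
  have modE (x : nat) : (x%:Z ^+ 2 == a %[mod p])%Z = ((x%:R : 'F_p) ^+ 2 == a%:~R).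
    by rewrite eqz_mod_dvd dvdE rmorphB rmorphXn /= subr_eq0.
  apply/existsP/existsP => -[x xE]; first by exists x%:R; rewrite -modE.
  have xp : (x < p)%N by rewrite -[X in (_ < X)%N](Fp_cast p_pr).
  by exists (Ordinal xp); rewrite modE /= natr_Zp.
rewrite euler_criterion ?card_Fp // ahE; case: eE => ->; first by rewrite eqxx.
case: ifP => // /eqP minus1E; have : (p %| 2)%N.
  by rewrite (dvdn_pcharf (pchar_Fp p_pr)) mulr2n -{1}minus1E mulrNz addNr.
by move/dvdn_leq => /(_ isT); lia.
Qed.

Lemma fact_parity_split h :
  h`! = ((\prod_(j < h./2) j.+1.*2) * \prod_(i < h - h./2) i.*2.+1)%N.
Proof.
elim: h => [|h IHh]; first by rewrite !big_ord0.
rewrite factS IHh; have [h_odd|h_even] := boolP (odd h).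
  have -> : (h.+1)./2 = (h./2).+1 by lia.
  have -> : (h.+1 - (h./2).+1 = h - h./2)%N by lia.
  rewrite big_ord_recr /= ; have -> : (h./2).+1.*2 = h.+1 by lia.
  by rewrite mulnA [(h.+1 * _)%N]mulnC.
have -> : (h.+1)./2 = h./2 by lia.
have -> : (h.+1 - h./2 = (h - h./2).+1)%N by lia.
rewrite big_ord_recr /= ; have -> : ((h - h./2).*2).+1 = h.+1 by lia.
by rewrite mulnC mulnA.
Qed.

(* Gauss' lemma: among the residues 2, 4, ..., p - 1, those above p / 2 are the negatives of the
   odd numbers below p / 2. *)
Lemma Fp_exp2_half (p : nat) : prime p -> odd p ->
  (2 : 'F_p) ^+ p./2 = (-1) ^+ (p./2 - p./2./2).
Proof.
move=> p_pr p_odd; set h := p./2.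
have pE : p = h.*2.+1 by rewrite /h; lia.
have p0 : p%:R = 0 :> 'F_p by apply: pchar_Fp_0.
have fact0 : h`!%:R != 0 :> 'F_p.
  elim: {-2}h (leqnn h) => [|n IHn] n_le; first by rewrite fact0 oner_eq0.
  rewrite factS natrM mulf_neq0 ?IHn ?(ltnW n_le) //.
  by rewrite -(dvdn_pcharf (pchar_Fp p_pr)) gtnNdvd // pE; lia.
apply: (mulIf fact0).
(* 2^h h! is the product of 2, 4, ..., 2h, to be compared with h! split into its even and odd
   factors. *)
transitivity (\prod_(j < h) (j.+1.*2)%:R : 'F_p).
  under eq_bigr do rewrite -muln2 natrM.
  rewrite big_split /= prodr_const card_ord mulrC -natr_prod; congr (_%:R * _).
  by rewrite fact_prod big_add1 big_mkord.
rewrite [in RHS]fact_parity_split natrM !natr_prod.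
rewrite -(big_mkord xpredT (fun j => (j.+1.*2)%:R : 'F_p)).
rewrite (big_cat_nat _ (n := h./2)) //=; last by lia.
rewrite big_mkord mulrCA; congr (_ * _).
(* After reversal the i-th factor of the upper half is 2(h - i) = p - (2i + 1). *)
rewrite -{1}[h./2]add0n big_addn big_mkord (reindex_inj rev_ord_inj) /=.
rewrite -[in X in _ = X * _](card_ord (h - h./2)%N) -prodrN.
apply: eq_bigr => i _; apply/eqP; rewrite -subr_eq0 opprK -natrD.
rewrite -p0; apply/eqP; congr (_%:R); have := ltn_ord i; lia.
Qed.

Lemma kronecker_prime_N1 p : prime p -> odd p -> kronecker_prime (-1) p = chi4 p.
Proof.
move=> p_pr p_odd; apply: kronecker_prime_euler => //.
  by rewrite /chi4; case: ifP; [left|right].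
rewrite mulrNz -signr_odd /chi4; case: ifP => p4; case: (boolP (odd _)) => //; lia.
Qed.

Lemma kronecker_prime_exp2 p a : prime p -> odd p -> kronecker_prime (2 ^+ a) p = chi8 p ^+ a.
Proof.
move=> p_pr p_odd; apply: kronecker_prime_euler => //.
  rewrite /chi8; case: ifP => _; first by rewrite expr1n; left.
  by rewrite -signr_odd; case: (odd a); [right|left].
rewrite !rmorphXn exprAC Fp_exp2_half // /chi8; congr (_ ^+ _); rewrite -signr_odd.
by case: ifP => p8; case: (boolP (odd _)) => //; lia.
Qed.

(** The product over primes only sees |n|; at negative n the sign factor -1 accounts for
    [chi4 (- n) = - chi4 n]. *)
Lemma kronecker_N1 n : ~~ (2 %| n)%Z -> kronecker (-1) n = chi4 n.
Proof.
move=> n_odd; have nO : odd `|n| by lia.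
rewrite /kronecker; case: eqP => [n0|n0]; first by rewrite n0 in n_odd.
have -> : \prod_(p <- primes `|n|) kronecker_prime (-1) p ^+ logn p `|n| = chi4 `|n|%N.
  rewrite -(@prod_primes_logn (fun p => chi4 p%:Z)) //; last first.
    by move=> m1 m2 m1O m2O /=; rewrite PoszM chi4M //; lia.
  apply: eq_big_seq => p; rewrite mem_primes => /and3P[p_pr _ pn].
  by rewrite kronecker_prime_N1 // (dvdn_odd pn).
by rewrite /chi4; case: ifP => ?; case: ifP => ?; case: ifP => ?; lia.
Qed.

(** No sign arises, since 2^a is positive and [chi8] is even. The power is there for D1 and D2,
    which are powers of 2. *)
Lemma kronecker_exp2 a n : ~~ (2 %| n)%Z -> kronecker (2 ^+ a) n = chi8 n ^+ a.
Proof.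
move=> n_odd; have nO : odd `|n| by lia.
rewrite /kronecker; case: eqP => [n0|n0]; first by rewrite n0 in n_odd.
rewrite ltNge exprn_ge0 //= mul1r.
have -> : \prod_(p <- primes `|n|) kronecker_prime (2 ^+ a) p ^+ logn p `|n| = chi8 `|n|%N ^+ a.
  rewrite -(@prod_primes_logn (fun p => chi8 p%:Z ^+ a)) //; last 2 first.
  - by rewrite expr1n.
  - by move=> m1 m2 m1O m2O /=; rewrite PoszM chi8M ?exprMn //; lia.
  apply: eq_big_seq => p; rewrite mem_primes => /and3P[p_pr _ pn].
  by rewrite kronecker_prime_exp2 // (dvdn_odd pn).
by rewrite /chi8; congr (_ ^+ _); case: ifP => ?; case: ifP => ?; lia.
Qed.

(** * Double cosets and Plücker coordinates *)

Lemma forall_I3 (P : 'I_3 -> Prop) : P 0 -> P 1 -> P 2 -> forall i, P i.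
Proof.
move=> P0 P1 P2 [[|[|[|//]]] i_lt];
  [rewrite (_ : Ordinal _ = 0)|rewrite (_ : Ordinal _ = 1)|rewrite (_ : Ordinal _ = 2)] => //;
  exact: val_inj.
Qed.

Lemma sum_I3 (V : zmodType) (F : 'I_3 -> V) : \sum_i F i = F 0 + F 1 + F 2.
Proof.
rewrite !big_ord_recl big_ord0 addr0 addrA; congr (F _ + F _ + F _); exact: val_inj.
Qed.

Lemma mulmx3E (A B : 'M[int]_3) i j :
  (A *m B) i j = A i 0 * B 0 j + A i 1 * B 1 j + A i 2 * B 2 j.
Proof. by rewrite mxE sum_I3. Qed.

Lemma det2E (A : 'M[int]_2) : \det A = A 0 0 * A 1 1 - A 0 1 * A 1 0.
Proof.
rewrite (expand_det_row _ 0) !big_ord_recl big_ord0 addr0 /cofactor !det_mx11 !mxE /=.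
rewrite expr0 expr1 mul1r mulN1r mulrN.
by congr (A _ _ * A _ _ - A _ _ * A _ _); apply: val_inj.
Qed.

Lemma cofactor0E (A : 'M[int]_3) :
  [/\ cofactor A 0 0 = A 1 1 * A 2 2 - A 1 2 * A 2 1,
      cofactor A 0 1 = A 1 2 * A 2 0 - A 1 0 * A 2 2 &
      cofactor A 0 2 = A 1 0 * A 2 1 - A 1 1 * A 2 0].
Proof.
have E i j : cofactor A i j = (-1) ^+ (i + j) *
  (A (lift i 0) (lift j 0) * A (lift i 1) (lift j 1) -
   A (lift i 0) (lift j 1) * A (lift i 1) (lift j 0)).
  by rewrite /cofactor det2E !mxE.
have l00 : lift (0 : 'I_3) (0 : 'I_2) = 1 by apply: val_inj.
have l01 : lift (0 : 'I_3) (1 : 'I_2) = 2 by apply: val_inj.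
have l10 : lift (1 : 'I_3) (0 : 'I_2) = 0 by apply: val_inj.
have l11 : lift (1 : 'I_3) (1 : 'I_2) = 2 by apply: val_inj.
have l20 : lift (2 : 'I_3) (0 : 'I_2) = 0 by apply: val_inj.
have l21 : lift (2 : 'I_3) (1 : 'I_2) = 1 by apply: val_inj.
by rewrite !E // l00 l01 l10 l11 l20 l21 /=; split; ring.
Qed.

Lemma det3E (A : 'M[int]_3) : \det A =
  A 0 0 * (A 1 1 * A 2 2 - A 1 2 * A 2 1) +
  A 0 1 * (A 1 2 * A 2 0 - A 1 0 * A 2 2) +
  A 0 2 * (A 1 0 * A 2 1 - A 1 1 * A 2 0).
Proof. by rewrite (expand_det_row _ 0) sum_I3; have [-> -> ->] := cofactor0E A. Qed.

Definition mx3 (rows : seq (seq int)) : 'M[int]_3 :=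
  \matrix_(i, j) nth 0 (nth [::] rows i) j.

Definition unip (x y z : int) : 'M[int]_3 :=
  mx3 [:: [:: 1; x; z]; [:: 0; 1; y]; [:: 0; 0; 1]].

Lemma Gamma_infP (u : 'M[int]_3) : Gamma_inf u <-> exists x y z, u = unip x y z.
Proof.
split=> [[det_u uE]|[x [y [z ->]]]]; last first.
  split; first by rewrite det3E !mxE /=; ring.
  by apply: forall_I3; apply: forall_I3 => //; rewrite !mxE.
exists (u 0 1), (u 1 2), (u 0 2).
apply/matrixP; apply: forall_I3; apply: forall_I3; rewrite !mxE /=; by [|rewrite uE].
Qed.

Lemma unip_mul x y z x' y' z' :
  unip x y z *m unip x' y' z' = unip (x + x') (y + y') (z + z' + x * y').
Proof.
by apply/matrixP; apply: forall_I3; apply: forall_I3; rewrite mulmx3E !mxE /=; ring.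
Qed.

Lemma Gamma_infM u v : Gamma_inf u -> Gamma_inf v -> Gamma_inf (u *m v).
Proof.
move=> /Gamma_infP[x [y [z ->]]] /Gamma_infP[x' [y' [z' ->]]].
by apply/Gamma_infP; rewrite unip_mul; do 3 eexists.
Qed.

Lemma plucker_relation (gam : 'M[int]_3) :
  (plucker gam)`_0 * (plucker gam)`_5 + (plucker gam)`_1 * (plucker gam)`_4 +
  (plucker gam)`_2 * (plucker gam)`_3 = 0.
Proof. by rewrite /=; ring. Qed.

(** The first triple is the negated bottom row, multiplied by [unip x y z]. The second, read
    backwards, is the negated cross product of the two lower rows, multiplied by the inverse
    transpose. *)
Definition plucker_act (x y z : int) (p : seq int) : seq int :=
  [:: p`_0; p`_1 + x * p`_0; p`_2 + y * p`_1 + z * p`_0;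
      p`_3; p`_4 - y * p`_3; p`_5 - x * p`_4 + (x * y - z) * p`_3].

Lemma plucker_mul u x y z gam : Gamma_inf u ->
  plucker (u *m gam *m unip x y z) = plucker_act x y z (plucker gam) :> seq int.
Proof.
move=> /Gamma_infP[x' [y' [z' ->]]]; rewrite /plucker /plucker_act /=.
by rewrite !mulmx3E !mxE /=; congr [:: _; _; _; _; _; _]; ring.
Qed.

(** In u = gam' adj(gam), the bottom row sees only the bottom row of gam', and the first column only
    the first-row cofactors of gam. Both agree for the two matrices, so they are those of the
    identity, and det u = 1 fixes the middle entry. *)
Lemma same_plucker gam gam' : \det gam = 1 -> \det gam' = 1 -> plucker gam = plucker gam' ->
  exists2 u, Gamma_inf u & gam' = u *m gam.
Proof.
move=> det_gam det_gam' pE; exists (gam' *m \adj gam); last first.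
  by rewrite -mulmxA mul_adj_mx det_gam mulmx1.
have [p0 p1 p2 [p3 p4 p5]] : [/\ gam 2 0 = gam' 2 0, gam 2 1 = gam' 2 1, gam 2 2 = gam' 2 2 &
  [/\ cofactor gam 0 0 = cofactor gam' 0 0, cofactor gam 0 1 = cofactor gam' 0 1 &
      cofactor gam 0 2 = cofactor gam' 0 2]].
  have [-> -> ->] := cofactor0E gam; have [-> -> ->] := cofactor0E gam'.
  case: pE => e0 e1 e2 e3 e4 e5; do 3?split; try exact: oppr_inj.
  by rewrite -opprB e4 opprB.
set u := _ *m _.
have row2 j : u 2 j = (2 == j)%:R.
  have : (gam *m \adj gam) 2 j = (2 == j)%:R by rewrite mul_mx_adj det_gam mxE.
  by rewrite !mulmx3E p0 p1 p2.
have col0 i : u i 0 = (i == 0)%:R.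
  have : (gam' *m \adj gam') i 0 = (i == 0)%:R by rewrite mul_mx_adj det_gam' mxE.
  by rewrite !mulmx3E ![\adj _ _ _]mxE p3 p4 p5.
have det_u : \det u = 1.
  have := congr1 determinant (mul_adj_mx gam).
  by rewrite !det_mulmx det_gam det_gam' mulr1 mul1r => ->; rewrite det1.
split=> //; apply: forall_I3; apply: forall_I3 => //= _; rewrite ?row2 ?col0 //.
by move: det_u; rewrite det3E !row2 !col0 /= => <-; ring.
Qed.

Lemma double_coset_sub gam gam' x y z : \det gam = 1 -> \det gam' = 1 ->
  plucker gam' = plucker_act x y z (plucker gam) :> seq int ->
  (double_coset gam' `<=` double_coset gam)%classic.
Proof.
move=> det_gam det_gam' pE.
have Gv : Gamma_inf (unip x y z) by apply/Gamma_infP; do 3 eexists.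
have G1 : Gamma_inf 1%:M by split=> [|i j _]; rewrite ?det1 ?mxE.
have pvE := @plucker_mul _ x y z gam G1; rewrite mul1mx in pvE.
have [||u Gu gam'E] := @same_plucker (gam *m unip x y z) gam' _ det_gam'.
- by rewrite det_mulmx det_gam mul1r; case: Gv.
- by apply: val_inj; rewrite [RHS]pE -pvE.
move=> _ [u' Gu' [v' Gv' <-]]; exists (u' *m u); first exact: Gamma_infM.
by exists (unip x y z *m v'); [exact: Gamma_infM | rewrite gam'E !mulmxA].
Qed.

Lemma double_coset_eq gam gam' x y z : \det gam = 1 -> \det gam' = 1 ->
  plucker gam' = plucker_act x y z (plucker gam) :> seq int ->
  double_coset gam' = double_coset gam.
Proof.
move=> det_gam det_gam' pE; apply/seteqP; split; first exact: double_coset_sub pE.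
(* These are the parameters of the inverse of [unip x y z]. *)
apply: (@double_coset_sub _ _ (- x) (- y) (x * y - z)) => //.
rewrite pE /plucker_act /=; congr [:: _; _; _; _; _; _]; ring.
Qed.

Lemma double_coset_plucker gam gam' : double_coset gam gam' ->
  exists x y z, plucker gam' = plucker_act x y z (plucker gam) :> seq int.
Proof.
case=> u Gu [v /Gamma_infP[x [y [z vE]]] <-].
by exists x, y, z; rewrite vE; exact: plucker_mul.
Qed.

Lemma double_coset_refl gam : double_coset gam gam.
Proof.
have G1 : Gamma_inf 1%:M by split=> [|i j _]; rewrite ?det1 ?mxE.
by exists 1%:M => //; exists 1%:M => //; rewrite mul1mx mulmx1.
Qed.

Lemma SS_plucker A1 A2 gam : SS A1 A2 gam -> exists B1 C1 B2 C2 : int,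
  [/\ plucker gam = [:: 4 * A1; 4 * B1; C1; 4 * A2; 4 * B2; C2] :> seq int,
      (C1 == -1 %[mod 4])%Z & (C2 == -1 %[mod 4])%Z].
Proof.
case=> -[_ G] p0 p3.
have := (G 2 0 isT, G 2 1 isT, G 2 2 isT, G 1 0 isT, G 1 1 isT) => /=.
move: p0 p3; rewrite /plucker /=.
move: (gam 2 0) (gam 2 1) (gam 2 2) (gam 1 0) (gam 1 1) (gam 1 2) => g h i d e f.
move=> p0 p3 [[[[g4 h4] i4] d4] e4].
have [g' gE] : exists q, g = 4 * q by exists (g %/ 4)%Z; lia.
have [h' hE] : exists q, h = 4 * q by exists (h %/ 4)%Z; lia.
have [i' iE] : exists q, i = 4 * q + 1 by exists (i %/ 4)%Z; lia.
have [d' dE] : exists q, d = 4 * q by exists (d %/ 4)%Z; lia.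
have [e' eE] : exists q, e = 4 * q + 1 by exists (e %/ 4)%Z; lia.
exists (- h'), (- i), (d' * i - f * g'), (- (e * i - f * h)).
split; last 1 [rewrite hE eE iE; lia]; last by rewrite iE; lia.
by rewrite p0 p3 hE dE gE; congr [:: _; _; _; _; _; _]; ring.
Qed.

(* If v and n are orthogonal vectors with w . v = u . n = 1, then (w x n) x v = n, so the matrix
   with rows u, w x n, v has determinant 1. *)
Lemma SS_surj A B1 C1 B2 C2 : coprimez (4 * A) C1 -> coprimez (4 * A) C2 ->
  A * C2 + 4 * (B1 * B2) + C1 * A = 0 ->
  (C1 == -1 %[mod 4])%Z -> (C2 == -1 %[mod 4])%Z ->
  exists2 gam, SS A A gam &
    plucker gam = [:: 4 * A; 4 * B1; C1; 4 * A; 4 * B2; C2] :> seq int.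
Proof.
move=> /coprimezP[[x z] /= xz1] /coprimezP[[x' z'] /= xz1'] rel C14 C24.
(* In the notation above, v = (-4A, -4B1, -C1), n = (-C2, -4B2, -4A), and the Bézout coefficients
   give w = (-x, 0, -z) and u = (-z', 0, -x'). *)
set gam := mx3 [:: [:: - z'; 0; - x'];
  [:: - 4 * B2 * z; z * C2 - 4 * A * x; 4 * B2 * x]; [:: - 4 * A; - 4 * B1; - C1]].
have pE : plucker gam = [:: 4 * A; 4 * B1; C1; 4 * A; 4 * B2; C2] :> seq int.
  (* With these multiples of the hypotheses, the identities between coordinates become linear in the
     monomials. *)
  have relz := congr1 (fun t => z * t) rel; have relx := congr1 (fun t => x * t) rel.
  have xzA := congr1 (fun t => A * t) xz1; have xzB := congr1 (fun t => B2 * t) xz1.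
  have xzC := congr1 (fun t => C2 * t) xz1.
  rewrite /plucker /= !mxE /= in relz relx xzA xzB xzC *.
  by congr [:: _; _; _; _; _; _]; lia.
exists gam => //; split; [split|by rewrite pE|by rewrite pE].
  have : gam 0 0 * - plC2 gam - gam 0 2 * (plucker gam)`_3 = 1.
    rewrite /plC2 pE !mxE /=; lia.
  by rewrite det3E /plC2 /= => <-; rewrite !mxE /=; ring.
have [q qE] : exists q, C1 = 4 * q - 1 by exists ((C1 + 1) %/ 4)%Z; lia.
have [q' q'E] : exists q, C2 = 4 * q - 1 by exists ((C2 + 1) %/ 4)%Z; lia.
apply: forall_I3; apply: forall_I3 => //= _; rewrite !mxE /=; move: xz1 xz1'; rewrite ?qE ?q'E; lia.
Qed.

(** * The splitting for A1 = A2 = 2^k *)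

Lemma chi4_sqr n : chi4 n ^+ 2 = 1.
Proof. by rewrite /chi4; case: ifP. Qed.

Lemma chi8_sqr n : chi8 n ^+ 2 = 1.
Proof. by rewrite /chi8; case: ifP. Qed.

Lemma odd_int_mod4 n : ~~ (2 %| n)%Z -> exists q, n = 4 * q + 1 \/ n = 4 * q - 1.
Proof. by exists ((n + 1) %/ 4)%Z; lia. Qed.

(** As [chi8] is even, the argument may be taken as C + 2 b1 b2. For C = 3 mod 4, adding 2 modulo 8
    keeps [chi8] and subtracting 2 flips it; the sign is that of b1 b2 modulo 4. *)
Lemma chi8_opp_addM C b1 b2 : (C == -1 %[mod 4])%Z -> ~~ (2 %| b1)%Z -> ~~ (2 %| b2)%Z ->
  chi8 (- C - 2 * (b1 * b2)) = chi8 C * chi4 b1 * chi4 b2.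
Proof.
move=> C4 /odd_int_mod4[q1 E1] /odd_int_mod4[q2 E2].
have [c Ec] : exists c, C = 8 * c - 1 \/ C = 8 * c + 3 by exists ((C + 1) %/ 8)%Z; lia.
rewrite /chi8 /chi4; case: E1 => ->; case: E2 => ->; case: Ec => ->.
all: by do 4 (case: ifP => ?); lia.
Qed.

Lemma kronecker_n1 a : kronecker a 1 = 1.
Proof. by rewrite /kronecker /= andbF big_nil. Qed.

(** The prime 2 contributes 1 because e is 1 or -1 modulo 8, and the negative sign contributes e. *)
Lemma kronecker_unit_Nexp2 (e : int) j : e = 1 \/ e = -1 -> kronecker e (- 2 ^+ j) = e.
Proof.
move=> eE; rewrite /kronecker oppr_eq0 expf_eq0 andbF oppr_lt0 exprn_gt0 // andbT abszN abszX.
have -> : \prod_(p <- primes (`|2| ^ j)) kronecker_prime e p ^+ logn p (`|2| ^ j) = 1.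
  rewrite big_seq big1 // => p; rewrite mem_primes => /and3P[p_pr _ pj].
  have /eqP-> : p == 2%N by rewrite -dvdn_prime2 // (Euclid_dvdX _ _ p_pr) in pj *; case/andP: pj.
  by rewrite /kronecker_prime; case: eE => ->; rewrite ?expr1n.
by case: eE => ->.
Qed.

(** The last entry is C2, eliminated by the Plücker relation. *)
Definition coords (k a : nat) (b1 b2 C1 : int) (gam : 'M[int]_3) : Prop :=
  plucker gam = [:: 4 * 2 ^+ k; 4 * (2 ^+ a * b1); C1; 4 * 2 ^+ k;
                    4 * (2 ^+ (k - a.+1) * b2); - C1 - 2 * (b1 * b2)] :> seq int.

(** This is (-1 / b1) (2 / C1)^a (2 / C2)^(k - a) after [chi8_opp_addM] has removed C2. *)
Definition weight (k a : nat) (b1 b2 C1 : int) : int :=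
  chi8 C1 ^+ k * chi4 b1 ^+ (k - a).+1 * chi4 b2 ^+ (k - a).

(** Here D = 2^k, D1 = 2^a, D2 = 2^(k - a) and A1/D = A2/D = 1, so the explicit formula applies
    directly. Its second, third and fourth symbols are 1, and the first is [eps] itself. *)
Lemma splitting_weight k a b1 b2 C1 gam : (a < k)%N -> ~~ (2 %| b1)%Z -> ~~ (2 %| b2)%Z ->
  (C1 == -1 %[mod 4])%Z -> coords k a b1 b2 C1 gam ->
  splitting gam = weight k a b1 b2 C1.
Proof.
move=> ak b1o b2o C14 pE.
have A1E : plA1 gam = 2 ^+ k by rewrite /plA1 pE mulKz.
have A2E : plA2 gam = 2 ^+ k by rewrite /plA2 pE mulKz.
have B1E : plB1 gam = 2 ^+ a * b1 by rewrite /plB1 pE mulKz.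
have exp2_neq0 j : (2 : int) ^+ j != 0 by rewrite expf_neq0.
have gcdA : gcdz (2 ^+ k) (2 ^+ k) = 2 ^+ k by rewrite gcdzz gez0_abs ?exprn_ge0.
have ka : (2 : int) ^+ k = 2 ^+ a * 2 ^+ (k - a) by rewrite -exprD subnKC // ltnW.
have gcdB : gcdz (2 ^+ k) (2 ^+ a * b1) = 2 ^+ a.
  have co : coprimez 2 b1 by rewrite coprimezE prime_coprime.
  by rewrite ka -mulz_gcdr (eqP (coprimezXl (k - a) co)) mulr1 gez0_abs ?exprn_ge0.
have divA : (2 ^+ k %/ 2 ^+ a)%Z = 2 ^+ (k - a) :> int by rewrite ka mulKz.
rewrite /splitting A1E A2E gcdA divzz exp2_neq0 /= /splitting_odd A1E exprn_gt0 //.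
rewrite /splitting_formula A1E A2E B1E gcdA gcdB divzz exp2_neq0 /= mulKz //.
rewrite !divA ger0_norm ?exprn_ge0 // divzz exp2_neq0 /= !kronecker_n1 kronecker_N1 // !mulr1.
rewrite mulNr -exprD kronecker_unit_Nexp2; last by rewrite /chi4; case: ifP; [left|right].
rewrite /plC1 /plC2 pE /= !kronecker_exp2 //; [|lia|lia].
have -> : weight k a b1 b2 C1 =
    chi8 C1 ^+ a * chi8 C1 ^+ (k - a) * chi4 b1 ^+ (k - a).+1 * chi4 b2 ^+ (k - a).
  by rewrite -exprD subnKC // ltnW.
rewrite chi8_opp_addM // !exprMn exprS; ring.
Qed.

Lemma chi4D b x : chi4 (b + 4 * x) = chi4 b.
Proof. by rewrite /chi4; case: ifP => ?; case: ifP => ?; lia. Qed.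

(** The factors are not all invariant separately. If k - a = 1, [chi4 b1] may change but its
    exponent is 2. If a = 0 and y is odd, [chi4 b2] and [chi8 C1] both flip, and they carry the same
    exponent k. Otherwise the shifts of b1 and b2 are multiples of 4, and that of C1 is a multiple
    of 8. *)
Lemma weight_shift (k a : nat) (b1 b2 C1 x y z : int) : (a < k)%N ->
  ~~ (2 %| b1)%Z -> ~~ (2 %| b2)%Z ->
  (C1 == -1 %[mod 4])%Z ->
  weight k a (b1 + x * 2 ^+ (k - a)) (b2 - y * 2 ^+ a.+1)
    (C1 + 4 * (y * (2 ^+ a * b1)) + 4 * (z * 2 ^+ k)) = weight k a b1 b2 C1.
Proof.
move=> ak b1o b2o C14; rewrite /weight.
have -> : chi4 (b1 + x * 2 ^+ (k - a)) ^+ (k - a).+1 = chi4 b1 ^+ (k - a).+1.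
  case ka : (k - a)%N => [|[|n]]; first by lia.
    by rewrite !chi4_sqr.
  by rewrite -[X in _ + X](_ : 4 * (x * 2 ^+ n) = _) ?chi4D // !exprS; ring.
rewrite mulrAC [RHS]mulrAC; congr (_ * _).
case: k ak => // k ak; case: a ak => [|a] ak.
  rewrite subn0 -!exprMn; congr (_ ^+ _); rewrite !exprS expr0.
  have -> : C1 + 4 * (y * (1 * b1)) + 4 * (z * (2 * 2 ^+ k)) =
            C1 + 4 * (y * b1) + 8 * (z * 2 ^+ k) by ring.
  have [q1 E1] := odd_int_mod4 b1o.
  have [y' Ey] : exists y', y = 2 * y' \/ y = 2 * y' + 1 by exists (y %/ 2)%Z; lia.
  rewrite /chi8 /chi4; case: E1 => ->; case: Ey => ->; do 4 (case: ifP => ?); lia.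
have -> : C1 + 4 * (y * (2 ^+ a.+1 * b1)) + 4 * (z * 2 ^+ k.+1) =
          C1 + 8 * (y * (2 ^+ a * b1) + z * 2 ^+ k) by rewrite !exprS; ring.
have -> : b2 - y * 2 ^+ a.+2 = b2 + 4 * (- y * 2 ^+ a) by rewrite !exprS; ring.
rewrite chi4D; congr (_ ^+ _ * _); rewrite /chi8; do 2 (case: ifP => ?); lia.
Qed.

(** * Coordinates on the double cosets for A1 = A2 = 2^k *)

Lemma PoszX (m j : nat) : (m ^ j)%N%:Z = m%:Z ^+ j.
Proof. by elim: j => // j IHj; rewrite expnS exprS PoszM IHj. Qed.

Lemma exp2_odd_decomp (n : int) : n != 0 -> exists a b, n = 2 ^+ a * b /\ ~~ (2 %| b)%Z.
Proof.
move=> n0; have n_gt0 : (0 < `|n|)%N by lia.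
have [m co_m mE] := pfactor_coprime (isT : prime 2) n_gt0.
exists (logn 2 `|n|), (sgz n * m); split.
  by rewrite [LHS]intEsg [X in _ * Posz X]mE PoszM PoszX; ring.
by move: co_m; rewrite prime_coprime //; lia.
Qed.

Lemma exp2_odd_inj a a' (b b' : int) : 2 ^+ a * b = 2 ^+ a' * b' ->
  ~~ (2 %| b)%Z -> ~~ (2 %| b')%Z -> a = a' /\ b = b'.
Proof.
wlog a_le : a a' b b' / (a <= a')%N.
  move=> H E b_odd b'_odd; case: (leqP a a') => [a_le|/ltnW a_le].
    exact: H a_le E b_odd b'_odd.
  by have [-> ->] := H _ _ _ _ a_le (esym E) b'_odd b_odd.
rewrite -(subnKC a_le) exprD -mulrA => /mulfI; rewrite expf_neq0 // => /(_ isT).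
case: (a' - a)%N => [|d] -> b_odd b'_odd; first by rewrite addn0 mul1r.
by case/negP: b_odd; rewrite exprS -mulrA dvdz_mulr.
Qed.

(** Writing C1 = 4u - 1 and C2 = 4v - 1 turns the Plücker relation into 2 B1 B2 = 2^k (1 - 2(u +
    v)). Comparing powers of 2 and odd parts gives 1 + a + a' = k and the value of C2. *)
Lemma SS_coords k gam : SS (2 ^+ k) (2 ^+ k) gam -> exists (a : nat) b1 b2 C1,
  [/\ (a < k)%N, ~~ (2 %| b1)%Z, ~~ (2 %| b2)%Z, (C1 == -1 %[mod 4])%Z &
      coords k a b1 b2 C1 gam].
Proof.
case/SS_plucker => B1 [C1 [B2 [C2 [pE C14 C24]]]].
have := plucker_relation gam; rewrite pE /= => rel.
have [u uE] : exists u, C1 = 4 * u - 1 by exists ((C1 + 1) %/ 4)%Z; lia.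
have [v vE] : exists v, C2 = 4 * v - 1 by exists ((C2 + 1) %/ 4)%Z; lia.
have relB : 2 ^+ 1 * (B1 * B2) = 2 ^+ k * (1 - 2 * (u + v)).
  by move: rel; rewrite uE vE expr1; lia.
have t_odd : ~~ (2 %| 1 - 2 * (u + v))%Z by lia.
have : B1 * B2 != 0.
  apply/eqP => B0; move: relB; rewrite B0 mulr0 => /esym/eqP.
  by rewrite mulf_eq0 expf_eq0 andbF /=; lia.
rewrite mulf_eq0 negb_or => /andP[].
move=> /exp2_odd_decomp[a [b1 [B1E b1o]]] /exp2_odd_decomp[a' [b2 [B2E b2o]]].
have b12o : ~~ (2 %| b1 * b2)%Z.
  have [q1 E1] := odd_int_mod4 b1o; have [q2 E2] := odd_int_mod4 b2o.
  by case: E1 => ->; case: E2 => ->; lia.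
have [|kE bE] := @exp2_odd_inj (1 + a + a') k (b1 * b2) (1 - 2 * (u + v)) _ b12o t_odd.
  by rewrite -relB B1E B2E !exprD; ring.
have ak : (a < k)%N by lia.
have a'E : a' = (k - a.+1)%N by lia.
exists a, b1, b2, C1; split => //; rewrite /coords pE B1E B2E a'E.
by congr [:: _; _; _; _; _; _]; rewrite bE uE vE; ring.
Qed.

Lemma coords_SS k a b1 b2 C1 : (a < k)%N -> ~~ (2 %| b1)%Z -> ~~ (2 %| b2)%Z ->
  (C1 == -1 %[mod 4])%Z ->
  exists2 gam, SS (2 ^+ k) (2 ^+ k) gam & coords k a b1 b2 C1 gam.
Proof.
move=> ak b1o b2o C14.
have co (C : int) : ~~ (2 %| C)%Z -> coprimez (4 * 2 ^+ k) C.
  move=> Co; rewrite (_ : 4 * 2 ^+ k = 2 ^+ k.+2); last by rewrite !exprS; ring.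
  by rewrite coprimezXl // coprimezE prime_coprime.
have [q1 E1] := odd_int_mod4 b1o; have [q2 E2] := odd_int_mod4 b2o.
apply: SS_surj => //.
- by apply: co; lia.
- by apply: co; lia.
- have -> : (2 : int) ^+ k = 2 * (2 ^+ a * 2 ^+ (k - a.+1)).
    by rewrite -exprD -exprS; congr (_ ^+ _); lia.
  ring.
- by case: E1 => ->; case: E2 => ->; lia.
Qed.

Lemma plucker_act_coords k a b1 b2 C1 x y z : (a < k)%N ->
  plucker_act x y z [:: 4 * 2 ^+ k; 4 * (2 ^+ a * b1); C1; 4 * 2 ^+ k;
     4 * (2 ^+ (k - a.+1) * b2); - C1 - 2 * (b1 * b2)] =
  let b1' := b1 + x * 2 ^+ (k - a) in let b2' := b2 - y * 2 ^+ a.+1 in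
  let C1' := C1 + 4 * (y * (2 ^+ a * b1)) + 4 * (z * 2 ^+ k) in
  [:: 4 * 2 ^+ k; 4 * (2 ^+ a * b1'); C1'; 4 * 2 ^+ k;
      4 * (2 ^+ (k - a.+1) * b2'); - C1' - 2 * (b1' * b2')].
Proof.
move=> ak; rewrite /plucker_act /=.
have -> : (2 : int) ^+ (k - a) = 2 * 2 ^+ (k - a.+1) by rewrite -exprS; congr (_ ^+ _); lia.
have -> : (2 : int) ^+ k = 2 * (2 ^+ a * 2 ^+ (k - a.+1)).
  by rewrite -exprD -exprS; congr (_ ^+ _); lia.
by rewrite exprS; congr [:: _; _; _; _; _; _]; ring.
Qed.

Lemma double_coset_coords k a b1 b2 C1 gam gam' : (a < k)%N -> coords k a b1 b2 C1 gam ->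
  double_coset gam gam' -> exists x y z,
  coords k a (b1 + x * 2 ^+ (k - a)) (b2 - y * 2 ^+ a.+1)
    (C1 + 4 * (y * (2 ^+ a * b1)) + 4 * (z * 2 ^+ k)) gam'.
Proof.
move=> ak cE /double_coset_plucker[x [y [z pE]]]; exists x, y, z.
by rewrite /coords pE cE plucker_act_coords.
Qed.

Lemma coords_double_coset k a b1 b2 C1 x y z gam gam' : (a < k)%N ->
  SS (2 ^+ k) (2 ^+ k) gam -> SS (2 ^+ k) (2 ^+ k) gam' -> coords k a b1 b2 C1 gam ->
  coords k a (b1 + x * 2 ^+ (k - a)) (b2 - y * 2 ^+ a.+1)
    (C1 + 4 * (y * (2 ^+ a * b1)) + 4 * (z * 2 ^+ k)) gam' ->
  double_coset gam' = double_coset gam.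
Proof.
move=> ak [[det1 _] _ _] [[det1' _] _ _] cE cE'; apply: (@double_coset_eq _ _ x y z) => //.
by rewrite cE' cE plucker_act_coords.
Qed.

(** Translated b1 remains odd, so 2^a b1 determines a and b1. The bounds then force x, y and z to
    vanish in this order: the translation of C1 is a multiple of 4 * 2^k once y = 0. *)
Lemma coords_inj k a a' b1 b1' b2 b2' C1 C1' gam gam' : (a < k)%N -> (a' < k)%N ->
  coords k a b1 b2 C1 gam -> coords k a' b1' b2' C1' gam' -> double_coset gam = double_coset gam' ->
  ~~ (2 %| b1)%Z -> ~~ (2 %| b1')%Z ->
  0 <= b1 < 2 ^+ (k - a) -> 0 <= b1' < 2 ^+ (k - a') ->
  0 <= b2 < 2 ^+ a.+1 -> 0 <= b2' < 2 ^+ a'.+1 ->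
  0 <= C1 < 4 * 2 ^+ k -> 0 <= C1' < 4 * 2 ^+ k ->
  [/\ a = a', b1 = b1', b2 = b2' & C1 = C1'].
Proof.
move=> ak a'k cE cE' dE b1o b1o' b1_bd b1_bd' b2_bd b2_bd' C_bd C_bd'.
have := double_coset_refl gam'; rewrite -dE => /(double_coset_coords ak cE)[x [y [z]]].
rewrite /coords cE' => -[E1 E2 E3 _].
have small (q s t N : int) : 0 <= s < N -> 0 <= t < N -> t = s + q * N -> q = 0.
  move=> s_bd t_bd tE; have N_gt0 : 0 < N by lia.
  by nia.
have [aE b1E] : a' = a /\ b1' = b1 + x * 2 ^+ (k - a).
  apply: exp2_odd_inj => //; first by lia.
  by rewrite (_ : (k - a)%N = (k - a.+1).+1) 1?exprS; lia.
subst a'; have x0 := small _ _ _ _ b1_bd b1_bd' b1E.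
move: b1E; rewrite x0 mul0r addr0 => b1E; subst b1'.
have b2E : b2' = b2 + (- y) * 2 ^+ a.+1.
  by rewrite mulNr; move: E3 => /(mulfI (isT : (4 : int) != 0)) /mulfI; apply; rewrite expf_neq0.
have /eqP := small _ _ _ _ b2_bd b2_bd' b2E; rewrite oppr_eq0 => /eqP y0.
move: E2; rewrite y0 !mul0r mulr0 addr0 mulrCA => C1E.
have z0 := small _ _ _ _ C_bd C_bd' C1E.
by rewrite C1E z0 b2E y0 oppr0 !mul0r !addr0; split.
Qed.

(** * The exponential sum *)

Lemma expi2piD (R : realType) (x y : R) : expi2pi (x + y) = expi2pi x * expi2pi y.
Proof.
rewrite /expi2pi mulrDr cosD sinD; apply/eqP; rewrite eq_complex /=.
by apply/andP; split; apply/eqP; ring.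
Qed.

Lemma expi2pi0 (R : realType) : expi2pi (0 : R) = 1.
Proof. by rewrite /expi2pi mulr0 cos0 sin0. Qed.

Lemma expi2pi_nat (R : realType) (n : nat) : expi2pi (n%:R : R) = 1.
Proof.
elim: n => [|n IHn]; first exact: expi2pi0.
by rewrite -addn1 natrD expi2piD IHn mul1r /expi2pi mulr1 mulr_natl cos2pi sin2pi.
Qed.

Lemma expi2pi_int (R : realType) (n : int) : expi2pi (n%:~R : R) = 1.
Proof.
case: n => n; first exact: expi2pi_nat.
have := expi2pi0 R; rewrite -(subrr n.+1%:R) expi2piD expi2pi_nat mul1r => <-.
by rewrite NegzE mulrNz.
Qed.

Lemma expi2piDint (R : realType) (x : R) (n : int) : expi2pi (x + n%:~R) = expi2pi x.
Proof. by rewrite expi2piD expi2pi_int mulr1. Qed.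

Definition coords_term (R : realType) (m1 m2 : int) (k a : nat) (b1 b2 C1 : int) : R[i] :=
  (weight k a b1 b2 C1)%:~R *
  (expi2pi (m1%:~R * b1%:~R / 2 ^+ (k - a) : R) * expi2pi (m2%:~R * b2%:~R / 2 ^+ a.+1 : R)).

Lemma Sigma_term_coords (R : realType) m1 m2 (k a : nat) b1 b2 C1 gam : (a < k)%N ->
  ~~ (2 %| b1)%Z -> ~~ (2 %| b2)%Z -> (C1 == -1 %[mod 4])%Z -> coords k a b1 b2 C1 gam ->
  Sigma_term R m1 m2 gam = coords_term R m1 m2 k a b1 b2 C1.
Proof.
move=> ak b1o b2o C14 cE; rewrite /Sigma_term (splitting_weight ak b1o b2o C14 cE).
congr (_ * _); rewrite -expi2piD; congr expi2pi.
rewrite /plA1 /plA2 /plB1 /plB2 cE /= !mulKz // !rmorphM !rmorphXn /=.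
have two_neq0 j : (2 : R) ^+ j != 0 by rewrite expf_neq0 // pnatr_eq0.
rewrite -!mulrA; congr (_ * _ + _ * _).
  have -> : (2%:~R : R) ^+ k = 2 ^+ a * 2 ^+ (k - a) by rewrite -exprD subnKC // ltnW.
  by field; rewrite !two_neq0.
have -> : (2%:~R : R) ^+ k = 2 ^+ (k - a.+1) * 2 ^+ a.+1 by rewrite -exprD subnK.
by field; rewrite !two_neq0.
Qed.

Lemma coords_term_shift (R : realType) m1 m2 (k a : nat) b1 b2 C1 x y z : (a < k)%N ->
  ~~ (2 %| b1)%Z -> ~~ (2 %| b2)%Z -> (C1 == -1 %[mod 4])%Z ->
  coords_term R m1 m2 k a (b1 + x * 2 ^+ (k - a)) (b2 - y * 2 ^+ a.+1)
    (C1 + 4 * (y * (2 ^+ a * b1)) + 4 * (z * 2 ^+ k)) = coords_term R m1 m2 k a b1 b2 C1.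
Proof.
move=> ak b1o b2o C14; rewrite /coords_term weight_shift //; congr (_ * (_ * _)).
  rewrite -[RHS](expi2piDint _ (m1 * x)); congr expi2pi.
  by rewrite rmorphD !rmorphM rmorphXn /=; field; rewrite expf_neq0 // pnatr_eq0.
rewrite -[RHS](expi2piDint _ (- (m2 * y))); congr expi2pi.
by rewrite rmorphB rmorphN !rmorphM rmorphXn /=; field; rewrite expf_neq0 // pnatr_eq0.
Qed.

(** The chosen element has translated coordinates, which leave the term unchanged. *)
Lemma Sigma_term_double_coset (R : realType) m1 m2 (k a : nat) b1 b2 C1 gam : (a < k)%N ->
  ~~ (2 %| b1)%Z -> ~~ (2 %| b2)%Z -> (C1 == -1 %[mod 4])%Z -> coords k a b1 b2 C1 gam ->
  Sigma_term R m1 m2 (xget 0 (double_coset gam)) = coords_term R m1 m2 k a b1 b2 C1.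
Proof.
move=> ak b1o b2o C14 cE.
have := xgetI 0 (double_coset_refl gam) => /(double_coset_coords ak cE)[x [y [z cE']]].
rewrite -(coords_term_shift _ _ _ x y z) //; apply: Sigma_term_coords cE' => //.
- by rewrite (_ : (k - a)%N = (k - a.+1).+1) 1?exprS; lia.
- by rewrite exprS; lia.
- lia.
Qed.

(** The residue is given as a translate of n, so that q can serve as a parameter of the action of
    [Gamma_inf]. *)
Lemma int_mod_exp2 (n : int) j : exists (r : nat) (q : int),
  (r < 2 ^ j)%N /\ r%:Z = n + q * 2 ^+ j.
Proof.
have exp_neq0 : (2 : int) ^+ j != 0 by rewrite expf_neq0.
exists `|(n %% 2 ^+ j)%Z|%N, (- (n %/ 2 ^+ j)%Z); split.
  by rewrite -ltz_nat PoszX gez0_abs ?modz_ge0 // ltz_pmod // exprn_gt0.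
by rewrite gez0_abs ?modz_ge0 // {2}(divz_eq n (2 ^+ j)); ring.
Qed.

Lemma Sigma_coords (R : realType) (k : nat) (m1 m2 : int) :
  Sigma R (2 ^+ k) (2 ^+ k) m1 m2 =
  \sum_(a < k) \sum_(x1 < 2 ^ (k - a) | odd x1) \sum_(x2 < 2 ^ a.+1 | odd x2)
    \sum_(c < 2 ^ k) coords_term R m1 m2 k a x1 x2 (4 * c%:Z + 3).
Proof.
(* The ranges of b1 and b2 depend on a; a fixed product of ordinals cut down by [P] makes the index
   type non-dependent. *)
pose P (t : 'I_k * 'I_(2 ^ k) * 'I_(2 ^ k) * 'I_(2 ^ k)) :=
  [&& odd t.1.1.2, (t.1.1.2 < 2 ^ (k - t.1.1.1))%N, odd t.1.2 & (t.1.2 < 2 ^ t.1.1.1.+1)%N].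
have exp2E j : (2 : int) ^+ j = (2 ^ j)%N%:Z by rewrite PoszX.
have c_bd (c : 'I_(2 ^ k)) : 0 <= 4 * c%:Z + 3 < 4 * 2 ^+ k.
  by rewrite exp2E; have := ltn_ord c; lia.
pose repr (t : 'I_k * 'I_(2 ^ k) * 'I_(2 ^ k) * 'I_(2 ^ k)) : 'M[int]_3 :=
  xget 0 [set gam | SS (2 ^+ k) (2 ^+ k) gam /\
                    coords k t.1.1.1 t.1.1.2 t.1.2 (4 * t.2%:Z + 3) gam]%classic.
have reprP t : P t -> SS (2 ^+ k) (2 ^+ k) (repr t) /\
                      coords k t.1.1.1 t.1.1.2 t.1.2 (4 * t.2%:Z + 3) (repr t).
  case/and4P=> o1 _ o2 _.
  have [|||gam SSg cE] := @coords_SS k t.1.1.1 t.1.1.2 t.1.2 (4 * t.2%:Z + 3) (ltn_ord _); [lia..|].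
  exact: (xgetI (P := [set gam | SS (2 ^+ k) (2 ^+ k) gam /\
                    coords k t.1.1.1 t.1.1.2 t.1.2 (4 * t.2%:Z + 3) gam]%classic) 0 (conj SSg cE)).
transitivity (\sum_(t | P t) Sigma_term R m1 m2 (xget 0 (double_coset (repr t)))).
  rewrite /Sigma (reindex_fsbig (fun t => double_coset (repr t)) [set` P]); last first.
    split.
    - by move=> t /= Pt; exists (repr t) => //; case: (reprP t Pt).
    - move=> t t'; rewrite !inE => Pt Pt' dE.
      have [_ cE] := reprP t Pt; have [_ cE'] := reprP t' Pt'.
      case/and4P: (Pt) => o1 lt1 o2 lt2; case/and4P: (Pt') => o1' lt1' o2' lt2'.
      have [||||||||aE b1E b2E cEq] := coords_inj (ltn_ord _) (ltn_ord _) cE cE' dE.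
      1-6: by rewrite ?exp2E; lia.
      1-2: exact: c_bd.
      case: t t' {Pt Pt' dE cE cE' o1 lt1 o2 lt2 o1' lt1' o2' lt2'} aE b1E b2E cEq
        => [[[a x1] x2] c] [[[a' x1'] x2'] c'] /= aE b1E b2E cEq.
      by congr (_, _, _, _); apply: val_inj => //=; lia.
    - move=> _ [gam SSg <-]; have [a [b1 [b2 [C1 [ak b1o b2o C14 cE]]]]] := SS_coords SSg.
      have [x1 [x [x1_lt x1E]]] := int_mod_exp2 b1 (k - a).
      have [x2 [y [x2_lt x2E]]] := int_mod_exp2 b2 a.+1.
      (* Moving b2 by y 2^(a + 1) drags C1 along by -4 y 2^a b1. The result is 3 modulo 4, hence the
         exact division after subtracting 3. *)
      have [c [z [c_lt cEq]]] := int_mod_exp2 ((C1 - 4 * (y * (2 ^+ a * b1)) - 3) %/ 4)%Z k.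
      have x1_ltk : (x1 < 2 ^ k)%N by rewrite (leq_trans x1_lt) // leq_exp2l // leq_subr.
      have x2_ltk : (x2 < 2 ^ k)%N by rewrite (leq_trans x2_lt) // leq_exp2l.
      pose t := (Ordinal ak, Ordinal x1_ltk, Ordinal x2_ltk, Ordinal c_lt).
      have x1o : odd x1.
        by move: x1E; rewrite (_ : (k - a)%N = (k - a.+1).+1) 1?exprS; lia.
      have x2o : odd x2 by move: x2E; rewrite exprS; lia.
      have Pt : P t by apply/and4P.
      exists t => //; have [SSt ct] := reprP t Pt.
      apply: (coords_double_coset (x := x) (y := - y) (z := z) ak SSg SSt cE).
      rewrite mulNr opprK -x1E -x2E; suff <- : 4 * c%:Z + 3 =
        C1 + 4 * (- y * (2 ^+ a * b1)) + 4 * (z * 2 ^+ k) by [].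
      by rewrite cEq; lia.
  by rewrite -(@bigfs _ _ _ _ (index_enum _) P) ?index_enum_uniq // => t _; rewrite mem_index_enum.
transitivity (\sum_(t | P t) coords_term R m1 m2 k t.1.1.1 t.1.1.2 t.1.2 (4 * t.2%:Z + 3)).
  apply: eq_bigr => t Pt; have [_ cE] := reprP t Pt.
  case/and4P: Pt => o1 _ o2 _.
  by apply: Sigma_term_double_coset cE => //; lia.
symmetry.
under eq_bigr => a _.
  rewrite (big_ord_widen_cond (2 ^ k) odd (fun x1 => \sum_(x2 < 2 ^ a.+1 | odd x2)
    \sum_(c < 2 ^ k) coords_term R m1 m2 k a x1 x2 (4 * c%:Z + 3))) ?leq_exp2l ?leq_subr //.
  under eq_bigr => x1 _.
    rewrite (big_ord_widen_cond (2 ^ k) odd (fun x2 => \sum_(c < 2 ^ k)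
      coords_term R m1 m2 k a x1 x2 (4 * c%:Z + 3))) ?leq_exp2l //.
  over.
over.
rewrite pair_big_dep /= pair_big_dep /= pair_big_dep /=.
by apply: eq_bigl => t; rewrite /P andbT -!andbA.
Qed.

(** * Twisted Gauss sums and the sum over C1 *)

Lemma chi4_exp_odd n e : chi4 n ^+ e = chi4 n ^+ odd e.
Proof. by rewrite -{1}(odd_double_half e) exprD -muln2 mulnC exprM chi4_sqr expr1n mulr1. Qed.

(** For n > 1 the odd residues split by class modulo 4, and [chi4 ^+ e] is (-1)^e on the class of
    -1. For n = 1 the convention cannot see the class, so e has to be even. *)
Lemma gauss_twist (R : realType) (m : int) (n e : nat) : (0 < n)%N -> (n == 1%N) ==> ~~ odd e ->
  gauss R 1 m n + (-1) ^+ e * gauss R (-1) m n =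
  \sum_(x < 2 ^ n | odd x) (chi4 x ^+ e)%:~R * expi2pi (m%:~R * x%:R / 2 ^+ n : R).
Proof.
move=> n_gt0; rewrite /gauss; case: eqP => /= [-> e_even|n1 _].
  (* The only terms are x = 1 and x = 3 modulo 4; their phases m/2 and 3m/2 differ by an integer, so
     the two halves add up to the single term at x = 1 modulo 2. *)
  rewrite -signr_odd (negbTE e_even) mul1r.
  have xE (x : nat) : (2 * m)%:~R * x%:R / 2 ^+ 2 = m%:~R * x%:R / 2 :> R.
    by rewrite rmorphM /=; field.
  have -> : gauss_unit_sum R 1 (2 * m) 2 = expi2pi (m%:~R / 2).
    rewrite /gauss_unit_sum big_mkcond !big_ord_recl big_ord0 /= xE add0r !addr0.
    by rewrite /bump /= ; congr expi2pi; field.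
  have -> : gauss_unit_sum R (-1) (2 * m) 2 = expi2pi (m%:~R / 2).
    rewrite /gauss_unit_sum big_mkcond !big_ord_recl big_ord0 /= xE !add0r !addr0.
    by rewrite -[RHS](expi2piDint _ m); rewrite /bump /=; congr expi2pi; field.
  rewrite big_mkcond !big_ord_recl big_ord0 /= add0r addr0 expr1.
  rewrite chi4_exp_odd (negbTE e_even) mul1r -mulrDl (_ : 2^-1 + 2^-1 = 1) ?mul1r; last by field.
  by rewrite /bump /=; congr expi2pi; field.
rewrite /gauss_unit_sum mulr_sumr [RHS](bigID (fun x : 'I_(2 ^ n) => (x%:Z == 1 %[mod 4])%Z)) /=.
have cop (x : nat) : coprime x (2 ^ n) = odd x by rewrite coprime_pexpr // coprimen2.
congr (_ + _); apply: eq_big => x.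
- by rewrite cop.
- by rewrite cop /chi4 => /andP[_ ->]; rewrite expr1n mul1r.
- by rewrite cop; case: (boolP (odd x)) => //= xo; lia.
- rewrite cop /chi4 => /andP[xo x4]; rewrite ifF; last by lia.
  by rewrite rmorphXn /= mulrNz.
Qed.

(** [chi8 (4 c + 3)] is (-1)^(c + 1). For odd k the sum alternates over an even number of terms and
    cancels. *)
Lemma sum_chi8 k : (0 < k)%N ->
  \sum_(c < 2 ^ k) chi8 (4 * c%:Z + 3) ^+ k = 2 ^+ k * (2 %| k)%N%:R.
Proof.
move=> k_gt0; case: (boolP (2 %| k)%N) => k2.
  rewrite mulr1 (eq_bigr (fun _ => 1)) => [|c _]; first by rewrite sumr_const card_ord -natrX.
  by rewrite -[X in _ ^+ X](divnK k2) mulnC exprM chi8_sqr expr1n.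
rewrite mulr0; case: k k_gt0 k2 => // k _ k2.
rewrite (eq_bigr (fun c : 'I__ => (-1) ^+ c.+1)) => [|c _].
  rewrite expnS mulnC; elim: (2 ^ k)%N => [|n IHn]; first by rewrite big_ord0.
  rewrite mulSn !big_ord_recr /= IHn add0r -signr_odd -[(-1) ^+ (_).+2]signr_odd /=.
  by case: (odd _).
have -> : chi8 (4 * c%:Z + 3) = (-1) ^+ c.+1.
  by rewrite -signr_odd /chi8; case: ifP => ?; case: (boolP (odd _)) => // ?; lia.
by rewrite -exprM -signr_odd -[LHS]signr_odd oddM (_ : odd k.+1) ?andbT //; lia.
Qed.

Theorem proposition26 (R : realType) (k : nat) (m1 m2 : int) (k_gt0 : (0 < k)%N) :
  Sigma R (2 ^+ k) (2 ^+ k) m1 m2 =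
  2 ^+ k * (2 %| k)%N%:R *
  \sum_(i < k)
    ((gauss R 1 m1 (k - i) + (-1) ^+ i.+1 * gauss R (-1) m1 (k - i)) *
     (gauss R 1 m2 i.+1 + (-1) ^+ i * gauss R (-1) m2 i.+1)).
Proof.
rewrite Sigma_coords.
pose S : int := \sum_(c < 2 ^ k) chi8 (4 * c%:Z + 3) ^+ k.
have -> : 2 ^+ k * (2 %| k)%N%:R = S%:~R :> R[i].
  by rewrite /S sum_chi8 // rmorphM rmorphXn /=; congr (_ * _); case: (2 %| k)%N.
rewrite mulr_sumr; apply: eq_bigr => a _.
have sumE (x1 x2 : nat) : \sum_(c < 2 ^ k) coords_term R m1 m2 k a x1 x2 (4 * c%:Z + 3) =
    S%:~R * (((chi4 x1 ^+ (k - a).+1)%:~R * expi2pi (m1%:~R * x1%:R / 2 ^+ (k - a) : R)) *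
            ((chi4 x2 ^+ (k - a))%:~R * expi2pi (m2%:~R * x2%:R / 2 ^+ a.+1 : R))).
  rewrite rmorph_sum mulr_suml; apply: eq_bigr => c _.
  by rewrite /coords_term /weight !rmorphM /=; ring.
under eq_bigr => x1 _ do under eq_bigr => x2 _ do rewrite sumE.
(* Odd k is settled first: there the parity condition of [gauss_twist] can fail, but S = 0. *)
case: (boolP (2 %| k)%N) => k2; last first.
  have -> : S = 0 by rewrite /S sum_chi8 // (negbTE k2) mulr0.
  by rewrite mul0r big1 // => x1 _; rewrite big1 // => x2 _; rewrite mul0r.
have ak := ltn_ord a.
rewrite !gauss_twist //; [|by apply/implyP; lia|lia|by apply/implyP; lia].
rewrite big_distrlr mulr_sumr /=; apply: eq_bigr => x1 _.
rewrite mulr_sumr; apply: eq_bigr => x2 _.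
(* For even k, the exponents k - a + 1 and k - a may be replaced by a + 1 and a, as only parity
   matters. *)
have odd_ka : odd (k - a) = odd a by lia.
rewrite [chi4 x1 ^+ (k - a).+1]chi4_exp_odd [chi4 x2 ^+ (k - a)]chi4_exp_odd /= odd_ka.
by rewrite -/(odd a.+1) -!chi4_exp_odd.
Qed.
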